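(* There exists a graph on 12 vertices such that it is not possible to construct a spectral graph drawing based on the adjacency matrix in a radical computation tree.
   Context: The adjacency matrix $A$ of a graph has $A_{ij}=1$ if $ij$ is an edge and $0$ otherwise. A spectral graph drawing based on a matrix $M$ takes eigenvectors $u_1,\dots,u_n$ of $M$ ordered by eigenvalue, chooses two of them $u_r,u_s$ with $r\neq s$, and places vertex $i$ at $(u_r[i],u_s[i])$. An algebraic computation tree is a rooted tree whose computation nodes compute a value as the sum, difference, product or quotient of integer constants and values computed at ancestor nodes, and whose decision nodes test whether a computed value is greater than zero and branch. A radical computation tree additionally allows computing the $k$-th root of a previously computed value ($k$ an integer parameter) and complex conjugation. *)

(* Defs.v *)
From mathcomp Require Import all_boot all_order all_algebra algC.
Set Implicit Arguments. Unset Strict Implicit. Unset Printing Implicit Defensive.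
Import Order.TTheory GRing.Theory Num.Theory.
Local Open Scope ring_scope.

Definition simple_graph n (e : rel 'I_n) : Prop :=
  (forall i, ~~ e i i) /\ (forall i j, e i j = e j i).

Definition adjmx n (e : rel 'I_n) : 'M[algC]_n := \matrix_(i, j) (e i j)%:R.

(* Operations of a computation node of a radical computation tree whose
   input is an n x n matrix.  Values computed at ancestor nodes are referred
   to by their index (in order of computation along the root path). *)
Inductive rop (n : nat) : Type :=
| RConst of int
| RInput of 'I_n & 'I_n
| RAdd of nat & nat
| RSub of nat & nat
| RMul of nat & nat
| RDiv of nat & nat
| RRoot of nat & nat
| RConj of nat.

Inductive rtree (n : nat) : Type :=
| RLeaf of seq nat
| RComp of rop n & rtree n
| RDec of nat & rtree n & rtree n.

Definition rop_eval n (M : 'M[algC]_n) (env : seq algC) (o : rop n) : algC :=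
  let v k := nth 0 env k in
  match o with
  | RConst z => z%:~R
  | RInput i j => M i j
  | RAdd a b => v a + v b
  | RSub a b => v a - v b
  | RMul a b => v a * v b
  | RDiv a b => v a / v b
  | RRoot k a => k.-root (v a)
  | RConj a => (v a)^*
  end.

Fixpoint rtree_eval_env n (M : 'M[algC]_n) (env : seq algC) (t : rtree n)
  : seq algC :=
  match t with
  | RLeaf outs => [seq nth 0 env k | k <- outs]
  | RComp o t' => rtree_eval_env M (rcons env (rop_eval M env o)) t'
  | RDec a tp tn =>
      if 0 < nth 0 env a then rtree_eval_env M env tp
      else rtree_eval_env M env tn
  end.

Definition rtree_eval n (M : 'M[algC]_n) (t : rtree n) : seq algC :=
  rtree_eval_env M [::] t.

Definition spectral_drawing n (M : 'M[algC]_n) (pos : 'I_n -> algC * algC)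
  : Prop :=
  exists (U : 'M[algC]_n) (lam : 'I_n -> algC) (r s : 'I_n),
    [/\ (forall i j, U i j \is Num.real) /\ U \in unitmx,
        (forall j, M *m col j U = lam j *: col j U),
        (forall j k : 'I_n, (j <= k)%N -> lam j <= lam k),
        r != s &
        (forall i, pos i = (U i r, U i s))].

Definition output_drawing n (out : seq algC) : 'I_n -> algC * algC :=
  fun i => (nth 0 out i, nth 0 out (n + i)).

(* Main.v *)
(* Let G be the automorphism group of the field algC.  Constants are fixed by G,
   field operations preserve the fixed field of each derived subgroup of G, and
   extracting a root moves at most two steps down the derived series: roots of
   unity are fixed by G', and an automorphism fixing both x and the roots of
   unity multiplies a root of x by a root of unity, so two such automorphisms
   commute on it.  Complex conjugation is harmless because derived subgroups are
   normal.  Hence every number computed by a radical tree is fixed by some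
   derived subgroup, and so are all its conjugates; if it is a root of an integer
   polynomial with transitive Galois group, that group is solvable.

   The graph is the disjoint union of two copies of a 6-vertex graph with
   characteristic polynomial f = x^6 - 8x^4 - 6x^3 + 7x^2 + 4x - 1.  Modulo 3,
   f is (x - 1) times an irreducible quintic, so lifting the Frobenius
   automorphism gives a 5-cycle in the Galois group of f; as f has no integer
   root, the group is 2-transitive on the six roots.  It is not solvable, for
   otherwise a minimal normal subgroup would be a transitive q-group and 6 would
   divide a power of q.  A radical eigenvector has a radical eigenvalue, which
   is a root of f. *)
From HB Require Import structures.
From mathcomp Require Import boolp classical_sets.
Require Import Defs.
From mathcomp Require Import all_boot all_order all_algebra algC.
From mathcomp Require Import all_fingroup all_solvable all_field.
From mathcomp Require Import zify ring.
Set Implicit Arguments. Unset Strict Implicit. Unset Printing Implicit Defensive.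
Import Order.TTheory GRing.Theory Num.Theory.
Local Open Scope ring_scope.

(** * Radical numbers and the derived series *)

Notation autC := {rmorphism algC -> algC}.

(* The fixed field of the [n]-th derived subgroup of Aut(algC): being fixed by
   the commutators suffices, so no generated subgroup is needed. *)
Fixpoint derived_level (n : nat) (x : algC) : Prop :=
  if n is n'.+1 then
    forall nu mu : autC,
      (forall y, derived_level n' y -> nu y = y) ->
      (forall y, derived_level n' y -> mu y = y) ->
      nu (mu x) = mu (nu x)
  else forall nu : autC, nu x = x.

Definition fixes_level n (nu : autC) := forall y, derived_level n y -> nu y = y.

Lemma derived_levelS n x : derived_level n x -> derived_level n.+1 x.
Proof. by move=> xn nu mu fnu fmu; rewrite (fmu x xn) (fnu x xn) fmu. Qed.

Lemma derived_level_le m n x :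
  (m <= n)%N -> derived_level m x -> derived_level n x.
Proof.
move=> /subnK <- xm; elim: (n - m)%N => // k; exact: derived_levelS.
Qed.

Lemma derived_level_int n z : derived_level n z%:~R.
Proof. by apply: (@derived_level_le 0) => // nu; rewrite rmorph_int. Qed.

Lemma derived_levelD n x y :
  derived_level n x -> derived_level n y -> derived_level n (x + y).
Proof.
case: n => [|n] xn yn; first by move=> nu; rewrite (rmorphD nu x y) xn yn.
move=> nu mu fnu fmu; rewrite (rmorphD mu x y) (rmorphD nu x y).
by rewrite (rmorphD nu (mu x)) (rmorphD mu (nu x)) (xn nu mu) // (yn nu mu).
Qed.

Lemma derived_levelN n x : derived_level n x -> derived_level n (- x).
Proof.
case: n => [|n] xn; first by move=> nu; rewrite (rmorphN nu x) xn.
move=> nu mu fnu fmu; rewrite (rmorphN mu x) (rmorphN nu x).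
by rewrite (rmorphN nu (mu x)) (rmorphN mu (nu x)) (xn nu mu).
Qed.

Lemma derived_levelM n x y :
  derived_level n x -> derived_level n y -> derived_level n (x * y).
Proof.
case: n => [|n] xn yn; first by move=> nu; rewrite (rmorphM nu x y) xn yn.
move=> nu mu fnu fmu; rewrite (rmorphM mu x y) (rmorphM nu x y).
by rewrite (rmorphM nu (mu x)) (rmorphM mu (nu x)) (xn nu mu) // (yn nu mu).
Qed.

Lemma derived_levelV n x : derived_level n x -> derived_level n x^-1.
Proof.
case: n => [|n] xn; first by move=> nu; rewrite (fmorphV nu x) xn.
move=> nu mu fnu fmu; rewrite (fmorphV mu x) (fmorphV nu x).
by rewrite (fmorphV nu (mu x)) (fmorphV mu (nu x)) (xn nu mu).
Qed.

Lemma derived_level_sum n (I : finType) (F : I -> algC) :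
  (forall i, derived_level n (F i)) -> derived_level n (\sum_i F i).
Proof.
move=> Fn; elim/big_ind: _ => // [|x y]; last exact: derived_levelD.
exact: (derived_level_int n 0).
Qed.

(** The automorphisms fixing level [n] form a normal subgroup: by induction [rho] preserves level
    [n], so conjugation by [rho] preserves that subgroup. *)
Lemma derived_level_aut n (rho : autC) x :
  derived_level n x -> derived_level n (rho x).
Proof.
elim: n rho x => [|n IHn] rho x xn; first by move=> nu; rewrite xn.
have fix_conj (nu : autC) : fixes_level n nu ->
    fixes_level n (algC_invaut rho \o nu \o rho).
  by move=> fnu y yn; rewrite /= fnu ?algC_autK //; exact: IHn.
move=> nu mu fnu fmu; apply: (fmorph_inj (algC_invaut rho)).
have := xn _ _ (fix_conj _ fnu) (fix_conj _ fmu).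
by rewrite /= !algC_invautK.
Qed.

(** Every automorphism raises a primitive [k]-th root of unity to some power, and power maps
    commute. *)
Lemma derived_level1_unity_root k x :
  (0 < k)%N -> x ^+ k = 1 -> derived_level 1 x.
Proof.
move=> k_gt0 xk1 nu mu _ _; have [w w_prim] := C_prim_root_exists k_gt0.
have [i ->] := prim_rootP w_prim xk1.
have auw (rho : autC) : exists a, rho w = w ^+ a.
  have : rho w ^+ k = 1.
    by rewrite -(rmorphXn rho k w) (prim_expr_order w_prim) rmorph1.
  by case/(prim_rootP w_prim) => a ->; exists a.
have [[a nuw] [b muw]] := (auw nu, auw mu).
rewrite (rmorphXn mu i w) (rmorphXn nu i w) nuw muw -!exprM.
rewrite (rmorphXn nu _ w) (rmorphXn mu _ w) nuw muw -!exprM.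
by congr (w ^+ _); lia.
Qed.

(* The automorphisms fixing level [n.+1] multiply [y] by roots of unity, which
   they fix, so they commute on [y]. *)
Lemma derived_level_root n k x y :
  (0 < k)%N -> y ^+ k = x -> derived_level n x -> derived_level n.+2 y.
Proof.
move=> k_gt0 yk xn nu mu fnu fmu.
have [->|y_neq0] := eqVneq y 0; first by rewrite !rmorph0.
have scal (rho : autC) : fixes_level n.+1 rho -> exists2 z, rho y = z * y &
    forall nu : autC, fixes_level n.+1 nu -> nu z = z.
  move=> frho; exists (rho y / y); first by rewrite divfK.
  move=> nu' fnu'; apply: fnu'; apply: (@derived_level_le 1) => //.
  apply: (derived_level1_unity_root k_gt0).
  rewrite expr_div_n -(rmorphXn rho k y) yk frho ?divff //; last first.
    exact: derived_levelS.
  by rewrite -yk expf_neq0.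
have [z nuy fz] := scal nu fnu; have [t muy ft] := scal mu fmu.
rewrite muy nuy (rmorphM nu t) (rmorphM mu z) nuy muy fz // ft //.
by rewrite mulrCA.
Qed.

(** * The Galois action on a finite family of numbers *)

Section RealisedPermutations.
Variables (m : nat) (r : 'I_m -> algC).
Hypothesis r_inj : injective r.

(** Carries the derived series of the infinite group Aut(algC) over to a finite group, where
    [solvable] makes sense. For [n = 0] every automorphism qualifies. *)
Definition level_perms n : {set {perm 'I_m}} :=
  [set p : {perm 'I_m} |
     `[< exists2 nu : autC, fixes_level n nu & forall i, nu (r i) = r (p i) >]].

Lemma level_permsP n (p : {perm 'I_m}) :
  reflect (exists2 nu : autC, fixes_level n nu & forall i, nu (r i) = r (p i))
          (p \in level_perms n).
Proof. by rewrite inE; exact: asboolP. Qed.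

Fact level_perms_group_set n : group_set (level_perms n).
Proof.
apply/group_setP; split=> [|p q].
  by apply/level_permsP; exists idfun => // i; rewrite perm1.
move=> /level_permsP[nu fnu nup] /level_permsP[mu fmu muq].
apply/level_permsP; exists (mu \o nu) => [y yn|i]; first by rewrite /= fnu ?fmu.
by rewrite /= nup muq permM.
Qed.
Canonical level_perms_group n := Group (level_perms_group_set n).

Lemma level_permsV (p : {perm 'I_m}) (nu : autC) :
  (forall i, nu (r i) = r (p i)) ->
  forall i, algC_invaut nu (r i) = r (p^-1%g i).
Proof. by move=> nup i; rewrite -{1}(permKV p i) -nup algC_autK. Qed.

(** A commutator of automorphisms fixing level [n] fixes level [n.+1], by the very definition of the
    levels. *)
Lemma der_level_perms n : (level_perms_group 0)^`(n)%g \subset level_perms n.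
Proof.
elim: n => [|n IHn]; first by rewrite derg0.
rewrite dergSn gen_subG; apply/subsetP => _ /imset2P[p q pn qn ->].
have /level_permsP[nu fnu nup] := subsetP IHn p pn.
have /level_permsP[mu fmu muq] := subsetP IHn q qn.
apply/level_permsP.
(* Permutations multiply from left to right, so p^-1 q^-1 p q is realised by composing in the
   reverse order. *)
exists (mu \o nu \o algC_invaut mu \o algC_invaut nu) => [y yn|i] /=; last first.
  rewrite (level_permsV nup) (level_permsV muq) nup muq -!permM.
  by rewrite commgEl conjgE !mulgA.
have fV (rho : autC) : fixes_level n rho -> fixes_level n (algC_invaut rho).
  by move=> frho z zn; apply: (fmorph_inj rho); rewrite algC_invautK frho.
(* The two automorphisms commute at the preimage of [y] under [nu], which still has level [n.+1]. *)
have -> : nu (algC_invaut mu (algC_invaut nu y)) =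
    algC_invaut mu (nu (algC_invaut nu y)).
  have := derived_level_aut (algC_invaut nu) yn; apply => //; exact: fV.
by rewrite !algC_invautK.
Qed.

(** An automorphism fixing level [n] fixes every [r i] and induces the identity, so the derived
    series is trivial from step [n] on. *)
Lemma solvable_level_perms n :
  (forall i, derived_level n (r i)) -> solvable (level_perms 0).
Proof.
move=> rn; rewrite -[level_perms 0]/(gval (level_perms_group 0)).
apply/derivedP; exists n; apply/trivgP.
apply: (subset_trans (der_level_perms n)).
apply/subsetP => p /level_permsP[nu fnu nup]; rewrite inE; apply/eqP/permP => i.
by apply: r_inj; rewrite -nup fnu // perm1.
Qed.

Lemma level0_permsP (p : {perm 'I_m}) :
  reflect (exists nu : autC, forall i, nu (r i) = r (p i)) (p \in level_perms 0).
Proof.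
apply: (iffP (level_permsP 0 p)) => [[nu _ nup]|[nu nup]]; exists nu => // y.
Qed.

Lemma aut_level0_perms (nu : autC) :
  (forall i, exists j, nu (r i) = r j) ->
  exists2 p, p \in level_perms 0 & forall i, nu (r i) = r (p i).
Proof.
move=> /choice[h Dh]; have h_inj : injective h.
  by move=> i j hij; apply/r_inj/(fmorph_inj nu); rewrite !Dh hij.
exists (perm h_inj) => [|i]; last by rewrite permE -Dh.
by apply/level0_permsP; exists nu => i; rewrite permE -Dh.
Qed.

End RealisedPermutations.

(** * Lifting Frobenius automorphisms *)

(** Galois descent: the roots of the minimal polynomial of [x] generate a Galois number field whose
    automorphisms extend to [algC], so [x] lies in its fixed field, the rationals. *)
Lemma fixed_Crat (x : algC) :
  (forall nu : {rmorphism algC -> algC}, nu x = x) -> x \in Crat.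
Proof.
move=> fix_x; have [p [Dp mon_p] _] := minCpolyP x.
have [s Ds] := closed_field_poly_normal (minCpoly x).
rewrite (monicP (minCpoly_monic x)) scale1r in Ds.
have xs : x \in s by rewrite -root_prod_XsubC -Ds root_minCpoly.
have [Qs [QsC [s1 Ds1 genQs]]] := num_field_exists s.
have [x1 x1s Dx1] : exists2 x1, x1 \in s1 & x = QsC x1.
  by apply/mapP; rewrite Ds1.
pose p1 : {poly Qs} := map_poly (in_alg Qs) p.
have Dp1 : map_poly QsC p1 = minCpoly x.
  rewrite Dp -map_poly_comp; apply: eq_map_poly => a /=.
  by rewrite alg_num_field fmorph_rat.
have p1_split : p1 = \prod_(z <- s1) ('X - z%:P).
  apply: (map_poly_inj QsC); rewrite Dp1 Ds -Ds1 big_map rmorph_prod /=.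
  by apply: eq_bigr => z _; rewrite map_polyXsubC.
have Qp1 : p1 \is a polyOver 1%VS.
  by apply/polyOverP => i; rewrite coef_map memvZ ?mem1v.
have sp1 : splittingFieldFor 1 p1 {:Qs} by exists s1; rewrite // p1_split eqpxx.
have Qs_ax : FieldExt_isSplittingField _ Qs by constructor; exists p1.
pose Ls : splittingFieldType rat := HB.pack Qs Qs_ax.
have galQ : galois 1 {:Ls}.
  apply/and3P; split; first exact: subvf.
    apply/separableP => y _; apply: pcharf0_separable => q.
    by rewrite pchar_lalg pchar_num.
  by apply/splitting_normalField; rewrite ?subvf //; exists p1.
have /galois_fixedField fixQ := galQ.
have : (x1 : Ls) \in fixedField 'Gal({:Ls} / 1)%g.
  apply/fixedFieldP; first exact: memvf.
  move=> g _.
  have [nu Dnu] := extend_algC_subfield_aut (QsC : {rmorphism Ls -> algC}) g.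
  apply: (fmorph_inj QsC); rewrite -[LHS]/(QsC (g x1)) Dnu -Dx1; exact: fix_x.
rewrite fixQ => /vlineP[a Da].
by rewrite Dx1 Da alg_num_field fmorph_rat Crat_rat.
Qed.

(** * Maximal ideals and residue fields *)

Section MaximalIdeal.
Local Open Scope classical_set_scope.
Variable R : comNzRingType.

(* Stable under unions of arbitrary chains, including the empty one, hence
   without [I 0]. *)
Definition proper_stable (I : set R) : Prop :=
  [/\ forall x y, I x -> I y -> I (x + y), forall c x, I x -> I (c * x) & ~ I 1].

Lemma maximal_ideal_exists (a : R) : (forall x, a * x <> 1) ->
  exists I : set R, [/\ proper_stable I, I a &
    forall b, ~ I b -> exists c, I (1 - c * b)].
Proof.
move=> a_nonunit.
(* The alternative [x = 0] is there for an empty [A]. *)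
pose adjoin (A : set R) (b : R) :=
  [set z | exists x c, [/\ A x \/ x = 0 & z = x + c * b]].
(* Requiring [A a] would exclude the union of the empty chain. Zorn's lemma runs instead on sets
   that stay proper once [a] is adjoined; [A a] then follows from maximality. *)
pose P (A : set R) := proper_stable A /\ ~ adjoin A a 1.
have genP A b :
    proper_stable A -> ~ adjoin A b 1 -> proper_stable (adjoin A b).
  move=> [AD AM A1] gen1.
  split=> // [_ _ [x [c [xA ->]]] [y [d [yA ->]]]|e _ [x [c [xA ->]]]].
    exists (x + y), (c + d); split; last by rewrite mulrDl addrACA.
    case: xA => [Ax|->]; last by rewrite add0r.
    by case: yA => [Ay|->]; [left; exact: AD | rewrite addr0; left].
  exists (e * x), (e * c); split; last by rewrite mulrDr mulrA.
  by case: xA => [Ax|->]; [left; exact: AM | rewrite mulr0; right].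
have sub_gen A b : A `<=` adjoin A b.
  by move=> x Ax; exists x, 0; split; [left | rewrite mul0r addr0].
have gen_b (A : set R) b : adjoin A b b.
  by exists 0, 1; split; [right | rewrite add0r mul1r].
have [F FP totF|A [[idA genA] maxA]] := @Zorn_bigcup R P.
  split; last first.
    move=> [x [c [[[X FX Xx]|->]]]] e1; last first.
      by apply: (a_nonunit c); rewrite mulrC e1 add0r.
    by have [_] := FP _ FX; apply; exists x, c; split=> //; left.
  split=> [x y [X FX Xx] [Y FY Yy]|c x [X FX Xx]|[X FX X1]].
  - have [XY|YX] := totF _ _ FX FY.
      by exists Y => //; have [[YD _ _] _] := FP _ FY; apply: YD => //; exact: XY.
    by exists X => //; have [[XD _ _] _] := FP _ FX; apply: XD => //; exact: YX.
  - by exists X => //; have [[_ XM _] _] := FP _ FX; exact: XM.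
  - by have [[_ _]] := FP _ FX.
have maxP b : ~ A b -> ~ P (adjoin A b).
  move=> nAb; apply: maxA; split; first exact: sub_gen.
  by move=> /(_ b (gen_b _ _)).
have Aa : A a.
  have [//|nAa] := pselect (A a); case: (maxP a nAa); split; first exact: genP.
  move=> [x [c [[[y [d [yA ->]]]|->] e1]]]; apply: genA.
    by exists y, (d + c); split=> //; rewrite mulrDl addrA.
  by exists 0, c; split; [right|].
have A0 : A 0 by have [_ AM _] := idA; rewrite -(mul0r a); exact: AM.
exists A; split=> // b nAb; have [AD AM A1] := idA.
have [[x [c [xA e1]]]|gen1] := pselect (adjoin A b 1).
  by exists c; rewrite e1 addrK; case: xA => [//|->].
case: (maxP b nAb); split; first exact: genP.
move=> [x [c [xA e1]]]; apply: gen1.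
have Aca : A (c * a) by exact: AM.
case: xA => [[y [d [yA xE]]]|x0]; last first.
  by exists (c * a), 0; split; [left | rewrite e1 x0; ring].
exists (y + c * a), d; split; last by rewrite e1 xE; ring.
by case: yA => [Ay|->]; left; [exact: AD | rewrite add0r].
Qed.
End MaximalIdeal.

Local Open Scope quotient_scope.

(* Krull's theorem: a non-unit vanishes in some residue field. *)
Lemma residue_field_exists (R : comNzRingType) (a : R) : (forall x, a * x <> 1) ->
  exists (k : fieldType) (phi : {rmorphism R -> k}), phi a = 0.
Proof.
move=> /maximal_ideal_exists[A [[AD AM A1] Aa maxA]].
pose I : {pred R} := fun x => `[< A x >].
have IP x : reflect (A x) (x \in I) by exact: asboolP.
have idI : idealr_closed I.
  split; first by apply/IP; rewrite -(mul0r a); exact: AM.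
    by apply/IP.
  by move=> c x y /IP Ax /IP Ay; apply/IP; apply: AD => //; exact: AM.
pose idM := isIdealr.Build R I idI.
pose J : idealr R := HB.pack I idM.
pose Q : comNzRingType := {ideal_quot J}.
pose phi : {rmorphism R -> Q} := \pi_Q.
have phi0 x : (phi x == 0) = (x \in I).
  by rewrite -(rmorph0 phi) -Quotient.idealrBE subr0.
(* The inverse of 0 is set to 0, as the field structure demands. *)
have invP (x : Q) : {y : Q | (x != 0 -> y * x = 1) /\ (x = 0 -> y = 0)}.
  apply: cid; have [->|x0] := eqVneq x 0; first by exists 0.
  have [b xb] : exists b, x = phi b.
    by exists (generic_quotient.repr (x : {ideal_quot J})); rewrite [RHS]reprK.
  have /maxA[c Ac] : ~ A b by move=> /IP; rewrite -phi0 -xb (negPf x0).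
  exists (phi c); split=> [_|x00]; last by rewrite x00 eqxx in x0.
  apply/esym/eqP; rewrite xb -subr_eq0 -rmorphM -(rmorph1 phi) -rmorphB phi0.
  exact/IP.
pose Qinv (x : Q) := sval (invP x).
have QmulVf (x : Q) : x != 0 -> Qinv x * x = 1 by case: (svalP (invP x)).
have Qinv0 : Qinv 0 = 0 by have [_] := svalP (invP 0); exact.
pose fieldM := GRing.ComNzRing_isField.Build Q QmulVf Qinv0.
pose k : fieldType := HB.pack (GRing.ComNzRing.sort Q) fieldM.
have /eqP phia : phi a == 0 by rewrite phi0; exact/IP.
by exists k, phi.
Qed.

(** The algebraic integers as a ring type, so that residue fields can be taken. *)
Record aint := AlgInt { aint_val :> algC; _ : aint_val \in Aint }.
HB.instance Definition _ := [isSub for aint_val].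
HB.instance Definition _ := [Choice of aint by <:].
HB.instance Definition _ := [SubChoice_isSubComNzRing of aint by <:].

Lemma aintP (x : aint) : (x : algC) \in Aint. Proof. exact: valP. Qed.

Section FrobeniusLift.
Variables (q n : nat) (k : fieldType) (phi : {rmorphism aint -> k}).
Variable (r : 'I_n -> aint).
Hypothesis charkq : q \in [pchar k].
Hypothesis r_inj : injective r.
Hypothesis r_stable : forall (nu : autC) i, exists j, nu (r i) = r j :> algC.

Let rC i : algC := \val (r i).
Let G := level_perms_group rC 0.

Let genpoly (S : comNzRingType) (f : aint -> S) (p : {perm 'I_n}) : {poly S} :=
  \sum_(i < n) f (r (p i)) *: 'X^i.

(** Kronecker's resolvent, with one linear factor for each element of the Galois group [G]. *)
Let resolvent (S : comNzRingType) (f : aint -> S) : {poly {poly S}} :=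
  \prod_(p in G) ('X - (genpoly f p)%:P).

Let map_resolvent (S : comNzRingType) (f : {rmorphism aint -> S}) :
  map_poly (map_poly f) (resolvent idfun) = resolvent f.
Proof.
rewrite /resolvent rmorph_prod /=; apply: eq_bigr => p _.
rewrite map_polyXsubC /genpoly rmorph_sum /=; congr ('X - _%:P).
by apply: eq_bigr => i _; rewrite map_polyZ map_polyXn.
Qed.

(** An automorphism of [algC] permutes the factors of the resolvent by right translation in [G].
    Each coefficient is thus rational and an algebraic integer. *)
Let resolvent_int i j : exists z : int, (resolvent idfun)`_i`_j = z%:~R.
Proof.
set c := _`_j.
have : \val c \in Num.int.
  apply: Cint_rat_Aint (aintP _); apply: fixed_Crat => nu.
  have [s sG Ds] := aut_level0_perms (inj_comp val_inj r_inj) (r_stable nu).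
  have Ec (f : {rmorphism aint -> algC}) : f c = (resolvent f)`_i`_j.
    by rewrite -map_resolvent !coef_map.
  have Er : resolvent (nu \o \val) = resolvent \val.
    rewrite /resolvent [RHS](reindex_inj (mulIg s)) /=.
    apply: eq_big => [p|p _]; first by rewrite groupMr.
    congr ('X - _%:P); apply: eq_bigr => l _; congr (_ *: _).
    by rewrite /= permM; exact: Ds.
  by rewrite [LHS](Ec (nu \o \val)) [RHS](Ec \val) Er.
by case/intrP => z cz; exists z; apply: val_inj; rewrite [LHS]cz rmorph_int.
Qed.

(** The Frobenius map fixes the images of integers, hence the reduced resolvent. It must send the
    factor of the identity to that of some [p], and comparing coefficients gives the action on the
    roots. *)
Lemma frobenius_lift :
  exists2 p, p \in level_perms (fun i => r i : algC) 0 &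
    forall i, phi (r i) ^+ q = phi (r (p i)).
Proof.
pose Fr := pFrobenius_aut charkq.
have : resolvent (Fr \o phi) = resolvent phi.
  rewrite -map_resolvent -(map_resolvent phi); apply/polyP => i; apply/polyP => j.
  by rewrite !coef_map /=; have [z ->] := resolvent_int i j; rewrite !rmorph_int.
(* The evaluation point is the root given by the identity on the left, so some factor on the right
   vanishes there. *)
move/(congr1 (fun P => P.[genpoly (Fr \o phi) 1])).
rewrite !horner_prod [LHS](bigD1 1%g) ?group1 //= hornerXsubC subrr mul0r.
move/esym/eqP/prodf_eq0 => [p Gp]; rewrite hornerXsubC subr_eq0 => /eqP Ep.
exists p => // i; have := congr1 (fun P : {poly k} => P`_i) Ep.
have coefg (f : aint -> k) s : (genpoly f s)`_i = f (r (s i)).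
  rewrite coef_sum (bigD1 i) //= coefZ coefXn eqxx mulr1 big1 ?addr0 // => j ji.
  by rewrite coefZ coefXn eq_sym (inj_eq val_inj) (negPf ji) mulr0.
by rewrite !coefg perm1 => <-; exact/esym/pFrobenius_autE.
Qed.

End FrobeniusLift.

(** * Permutation groups with a cycle fixing one point *)

Section NearlyCyclicPerm.
Variables (T : finType) (l : nat) (p : {perm T}) (x : T).
Hypotheses (l_prime : prime l) (cardT : #|T| = l.+1) (p_l : (p ^+ l)%g = 1%g).
Hypotheses (px : p x = x) (p_move : forall y, p y = y -> y = x).

(** The orbit of [g x] under [p] has size dividing the prime [l] and is not a single point, so it is
    everything but [x], and [g] joins [x] to it. A general [K] serves both for [G] and for the
    subgroups above a point stabiliser. *)
Let trans_of_move (K : {group {perm T}}) (g : {perm T}) :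
  p \in K -> g \in K -> g x != x -> [transitive K, on setT | 'P].
Proof.
move=> Kp Kg gx; set y := g x.
have cycle_y : orbit 'P <[p]> y = [set~ x].
  apply/eqP; rewrite eqEcard; apply/andP; split.
    apply/subsetP => z /imsetP[a /cycleP[i ->] ->]; rewrite !inE /=.
    have px_i : (p ^+ i)%g x = x.
      by elim: i => [|i IHi]; rewrite ?perm1 // expgSr permM IHi.
    by rewrite /aperm -{1}px_i (inj_eq perm_inj).
  rewrite cardsC1 cardT /=.
  have : (#|orbit 'P <[p]> y| %| l)%N.
    rewrite (dvdn_trans (dvdn_orbit 'P <[p]> y)) //.
    by rewrite -orderE order_dvdn p_l.
  case/primeP: l_prime => _ dvl /dvl /pred2P[/card_orbit1 y1|->//].
  have : aperm y p \in orbit 'P <[p]> y by rewrite mem_orbit ?cycle_id.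
  by rewrite y1 inE => /eqP /p_move yx; case/eqP: gx.
apply/imsetP; exists x; rewrite ?inE //; apply/esym/eqP; rewrite -subTset.
apply/subsetP => z _; have [->|zx] := eqVneq z x; first exact: orbit_refl.
have orb_y : y \in orbit 'P K x by exact: (mem_orbit 'P x Kg).
apply: (orbit_trans _ orb_y).
have : z \in orbit 'P <[p]> y by rewrite cycle_y !inE.
by case/imsetP => a pa ->; rewrite mem_orbit // (subsetP _ _ pa) ?cycle_subG.
Qed.

(** A subgroup of [G] strictly above the stabiliser of [x] contains [p] and moves [x], so it is
    transitive and equals [G]: the action is primitive. A solvable [G] would have a nontrivial
    normal elementary abelian subgroup, transitive by primitivity, and [l.+1] would divide a prime
    power. *)
Lemma trans_nonsolvable_nearly_cyclic (G : {group {perm T}}) (g : {perm T}) :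
  (forall q : nat, prime q -> ~~ q.-nat l.+1) ->
  p \in G -> g \in G -> g x != x ->
  [transitive G, on setT | 'P] /\ ~~ solvable G.
Proof.
move=> not_ppow Gp Gg gx; have trG := trans_of_move Gp Gg gx; split=> //.
have primG : [primitive G, on setT | 'P].
  rewrite (trans_prim_astab (in_setT x) trG); apply/maximal_eqP.
  split=> [|H sCH sHG]; first exact: subsetIl.
  have [HC|] := boolP (H \subset 'C_G[x | 'P]%g).
    by left; apply/eqP; rewrite eqEsubset HC.
  case/subsetPn => h Hh nCh; right.
  have Hp : p \in H.
    by apply: (subsetP sCH); rewrite inE Gp; apply/astab1P.
  have hx : h x != x.
    by apply: contraNneq nCh => hx; rewrite inE (subsetP sHG) //; apply/astab1P.
  have /(subgroup_transitiveP (in_setT x) sHG trG) <- := trans_of_move Hp Hh hx.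
  by rewrite mulSGid.
apply/negP => solG; have G1 : G :!=: 1%g.
  apply: contraNneq gx => G1; move: Gg; rewrite G1 inE => /eqP->.
  by rewrite perm1.
have [H [sHG nHG H1 abH]] := solvable_norm_abelem solG (normal_refl G) G1.
have [|trH] := prim_trans_norm primG nHG.
  move=> sHC; case/negP: H1; apply/eqP/trivgP.
  exact: subset_trans sHC (aperm_faithful _).
have [q q_pr /and3P[qH _ _]] := is_abelemP abH.
have := not_ppow q q_pr; rewrite -cardT -cardsT; case/negP.
exact: pnat_dvd (atrans_dvd trH) qH.
Qed.
End NearlyCyclicPerm.

(** * The sextic *)

Section SexticModThree.
Variables (R : comNzRingType) (x : R).
Hypothesis three0 : 3 = 0 :> R.
Hypothesis fx : x ^+ 6 - 8 * x ^+ 4 - 6 * x ^+ 3 + 7 * x ^+ 2 + 4 * x - 1 = 0.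

Let cong3 (a b q h : R) :
  a = (x ^+ 6 - 8 * x ^+ 4 - 6 * x ^+ 3 + 7 * x ^+ 2 + 4 * x - 1) * q
    + b + 3 * h ->
  a = b.
Proof. by rewrite fx three0 !mul0r add0r addr0. Qed.

(* Successive cubing modulo 3 and the sextic; the arguments [q] and [h] are
   the quotients of the two divisions. *)
Lemma sextic_frob5 : x ^+ 243 = x.
Proof.
have E9 : x ^+ 9 = - x ^+ 4 - x ^+ 3 + x ^+ 2 - x.
  apply: (cong3 (q := x ^+ 3 - x)
    (h := 3 * x ^+ 7 + 2 * x ^+ 6 - 5 * x ^+ 5 - 3 * x ^+ 4 + 3 * x ^+ 3
      + x ^+ 2)); ring.
have E27 : x ^+ 27 = x ^+ 5 - x ^+ 3 - x ^+ 2 - 1.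
  rewrite (exprM _ 9 3) E9.
  apply: (cong3 (q := - x ^+ 6 + x ^+ 4 - x ^+ 3 - x - 1)
    (h := - x ^+ 11 - 3 * x ^+ 10 - x ^+ 9 + 3 * x ^+ 8 + x ^+ 7 - 3 * x ^+ 6
      - 4 * x ^+ 5 - 2 * x ^+ 4 + 4 * x ^+ 2 + x)); ring.
have E81 : x ^+ 81 = - x ^+ 5 + x ^+ 4 + x ^+ 3.
  rewrite (exprM _ 27 3) E27.
  apply: (cong3 (q := x ^+ 9 - x ^+ 7 - x ^+ 4 + x ^+ 3 - x ^+ 2 + x + 1)
    (h := 2 * x ^+ 13 + x ^+ 12 - 4 * x ^+ 11 - 2 * x ^+ 10 + 3 * x ^+ 9
      + x ^+ 7 - x ^+ 5 + 4 * x ^+ 4 - 5 * x ^+ 2 - x)); ring.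
rewrite (exprM _ 81 3) E81.
apply: (cong3 (q := - x ^+ 9 + x ^+ 7 + x ^+ 6 - x ^+ 3 + x ^+ 2 + x)
    (h := x ^+ 14 - 3 * x ^+ 13 - 4 * x ^+ 12 + 5 * x ^+ 11 + 7 * x ^+ 10
      - 4 * x ^+ 8 - 4 * x ^+ 7 + x ^+ 6 + 7 * x ^+ 5 + x ^+ 4 - 4 * x ^+ 3
      - x ^+ 2)); ring.
Qed.

(** When [x ^+ 3 = x] the sextic collapses to -2x - 1, which is x - 1 modulo 3. *)
Lemma sextic_frob_fixed : x ^+ 3 = x -> x = 1.
Proof.
move=> x3; have x6 : x ^+ 6 = x ^+ 2 by rewrite (exprM _ 3 2) x3.
have x4 : x ^+ 4 = x ^+ 2 by rewrite exprSr x3.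
move: fx; rewrite x6 x4 x3 => fx'; apply/eqP; rewrite -subr_eq0 -fx'.
by apply/eqP/(cong3 (q := 0) (h := x)); ring.
Qed.

(** The Bezout identity (1 - x^2) f + v f' = 1 modulo 3 makes f separable there. *)
Lemma sextic_simple :
  6 * x ^+ 5 - 32 * x ^+ 3 - 18 * x ^+ 2 + 14 * x + 4 != 0.
Proof.
apply/eqP => f'x; have /eqP := oner_neq0 R; apply.
pose v := x ^+ 5 + x ^+ 3 - x ^+ 2 + x - 1.
rewrite -[RHS](mulr0 v) -f'x.
apply: (cong3 (q := 1 - x ^+ 2) (h := - (2 * x ^+ 10 - 9 * x ^+ 8 - 8 * x ^+ 7
  - x ^+ 6 + 6 * x ^+ 5 - 5 * x ^+ 4 - 2 * x ^+ 3 + 12 * x ^+ 2 - 2 * x - 2))).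
by rewrite /v; ring.
Qed.
End SexticModThree.

Definition sextic (R : comNzRingType) : {poly R} :=
  'X^6 - 8 *: 'X^4 - 6 *: 'X^3 + 7 *: 'X^2 + 4 *: 'X - 1.

Lemma horner_sextic (R : comNzRingType) (x : R) :
  (sextic R).[x] = x ^+ 6 - 8 * x ^+ 4 - 6 * x ^+ 3 + 7 * x ^+ 2 + 4 * x - 1.
Proof. by rewrite /sextic !hornerE. Qed.

Lemma map_sextic (R S : comNzRingType) (f : {rmorphism R -> S}) :
  map_poly f (sextic R) = sextic S.
Proof.
rewrite /sextic !(rmorphB, rmorphD) /= !map_polyZ !map_polyXn map_polyX.
by rewrite !rmorph_nat rmorph1.
Qed.

Lemma size_sextic (R : comNzRingType) : size (sextic R) = 7%N.
Proof.
rewrite /sextic -!addrA size_polyDl ?size_polyXn // ltnS.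
apply: (@leq_trans 5) => //; apply/leq_sizeP => j.
rewrite !(coefD, coefN, coefZ, coefXn, coefX, coef1).
by case: j => [|[|[|[|[|j]]]]] // _; rewrite !mulr0 !(subr0, addr0) oppr0.
Qed.

Lemma sextic_monic (R : comNzRingType) : sextic R \is monic.
Proof.
rewrite monicE lead_coefE size_sextic /sextic.
rewrite !(coefD, coefN, coefZ, coefXn, coefX, coef1) /=.
by rewrite !mulr0 !(subr0, addr0).
Qed.

Lemma deriv_sextic (R : comNzRingType) (x : R) : (sextic R)^`().[x] =
  6 * x ^+ 5 - 32 * x ^+ 3 - 18 * x ^+ 2 + 14 * x + 4.
Proof.
by rewrite /sextic !derivE !hornerE /=; ring.
Qed.

(** An integer root divides the constant term -1, and neither 1 nor -1 is a root. *)
Lemma sextic_no_int_root (z : int) : ~~ root (sextic algC) z%:~R.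
Proof.
rewrite /root horner_sextic.
have -> : z%:~R ^+ 6 - 8 * z%:~R ^+ 4 - 6 * z%:~R ^+ 3 + 7 * z%:~R ^+ 2
    + 4 * z%:~R - 1
  = (z ^+ 6 - 8 * z ^+ 4 - 6 * z ^+ 3 + 7 * z ^+ 2 + 4 * z - 1)%:~R :> algC.
  by ring.
rewrite intr_eq0; apply/eqP => fz.
have /intUnitRing.unitzPl :
    (z ^+ 5 - 8 * z ^+ 3 - 6 * z ^+ 2 + 7 * z + 4) * z = 1.
  by apply/eqP; rewrite -subr_eq0 -[X in _ == X]fz; apply/eqP; ring.
by case/orP => /eqP z1; rewrite z1 in fz.
Qed.

(** 3 is not a unit among algebraic integers, since 1/3 is rational but not an integer. *)
Lemma residue_field3_exists :
  exists (k : fieldType) (phi : {rmorphism aint -> k}), 3 \in [pchar k].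
Proof.
have [x /(congr1 \val) x3|k [phi phi3]] := @residue_field_exists aint 3.
  have {}x3 : 3 * (x : algC) = 1 by move: x3; rewrite rmorphM rmorph_nat rmorph1.
  have xE : (x : algC) = 3^-1.
    by apply: (@mulfI _ 3); rewrite ?x3 ?divff ?pnatr_eq0.
  have : (x : algC) \in Num.int.
    by apply: Cint_rat_Aint (aintP x); rewrite xE rpredV rpred_nat.
  case/intrP => z xz; move: x3.
  rewrite xz -[3](_ : 3%:~R = _ :> algC) // -rmorphM /=.
  move/eqP; rewrite -[1]/(1%:~R) eqr_int => /eqP; lia.
exists k, phi; rewrite inE /=; apply/eqP.
by rewrite -phi3 rmorph_nat.
Qed.

Lemma sextic_roots_aint :
  exists r : 'I_6 -> aint, sextic aint = \prod_i ('X - (r i)%:P).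
Proof.
have [s] := closed_field_poly_normal (sextic algC).
rewrite (monicP (sextic_monic _)) scale1r => Ds.
have sz_s : size s = 6%N.
  by have := size_sextic algC; rewrite Ds size_prod_XsubC => -[].
have sA (i : 'I_6) : s`_i \in Aint.
  apply: (root_monic_Aint _ (sextic_monic _)).
    by rewrite Ds root_prod_XsubC mem_nth ?sz_s.
  rewrite -(map_sextic (intr : {rmorphism int -> algC})).
  by apply/polyOverP => j; rewrite coef_map /= intr_int.
exists (fun i => AlgInt (sA i)); apply: (map_inj_poly val_inj (rmorph0 _)).
rewrite [LHS](map_sextic (\val : {rmorphism aint -> algC})) Ds.
rewrite (big_nth 0) sz_s big_mkord [RHS]rmorph_prod.
apply: eq_bigr => i _.
exact/esym/(map_polyXsubC (\val : {rmorphism aint -> algC})).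
Qed.

(** * The Galois group of the sextic *)

Section SexticRoots.
Variables (r : 'I_6 -> aint).
Hypothesis Dr : sextic aint = \prod_i ('X - (r i)%:P).

Lemma map_sextic_roots (S : comNzRingType) (f : {rmorphism aint -> S}) :
  sextic S = \prod_i ('X - (f (r i))%:P).
Proof.
rewrite -(map_sextic f) Dr rmorph_prod.
by apply: eq_bigr => i _; rewrite /= map_polyXsubC.
Qed.

Lemma sextic_rootP (S : idomainType) (f : {rmorphism aint -> S}) (x : S) :
  reflect (exists i, x = f (r i)) (root (sextic S) x).
Proof.
rewrite /root (map_sextic_roots f) horner_prod; apply: (iffP (prodf_eq0 _ _)).
  by move=> [i _]; rewrite hornerXsubC subr_eq0 => /eqP->; exists i.
by move=> [i ->]; exists i; rewrite // hornerXsubC subrr.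
Qed.

Lemma sextic_roots_stable (nu : autC) i : exists j, nu (r i) = r j :> algC.
Proof.
apply/(sextic_rootP (\val : {rmorphism aint -> algC})).
rewrite -(map_sextic nu) fmorph_root.
by apply/(sextic_rootP (\val : {rmorphism aint -> algC})); exists i.
Qed.

Section ResidueField.
Variables (k : fieldType) (phi : {rmorphism aint -> k}).
Hypothesis k3 : 3 \in [pchar k].

Let three0 : 3 = 0 :> k. Proof. exact: pcharf0 k3. Qed.

Let phi_root i : phi (r i) ^+ 6 - 8 * phi (r i) ^+ 4 - 6 * phi (r i) ^+ 3
  + 7 * phi (r i) ^+ 2 + 4 * phi (r i) - 1 = 0.
Proof.
by rewrite -horner_sextic; apply/eqP/(sextic_rootP phi); exists i.
Qed.

(** Two roots with the same reduction would give a double root, where the derivative vanishes. So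
    identities between permutations of the roots can be checked in [k]. *)
Lemma residue_roots_inj : injective (phi \o r).
Proof.
move=> i j /= xij; apply: contraTeq (sextic_simple three0 (phi_root i)) => ij.
rewrite -deriv_sextic (map_sextic_roots phi) (bigD1 i) //= (bigD1 j) 1?eq_sym //=.
by rewrite xij !derivM !hornerE /= subrr !(mul0r, mulr0, addr0, add0r) negbK.
Qed.

Lemma sextic_group :
  let G := level_perms_group (fun i => r i : algC) 0 in
  [transitive G, on setT | 'P] /\ ~~ solvable G.
Proof.
move=> G; have r_inj : injective r.
  by move=> i j rij; apply: residue_roots_inj; rewrite /= rij.
have [p Gp Dp] := frobenius_lift phi k3 r_inj sextic_roots_stable.
(* The sextic takes the value -3 at 1. *)
have [x phix] : exists x, 1 = phi (r x).
  apply/sextic_rootP; rewrite /root horner_sextic.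
  by apply/eqP; rewrite -[RHS](mul0r (-1)) -three0; ring.
have frobX m i : phi (r i) ^+ (3 ^ m) = phi (r ((p ^+ m)%g i)).
  elim: m => [|m IHm]; first by rewrite perm1.
  by rewrite expnSr exprM IHm Dp expgSr permM.
have p5 : (p ^+ 5)%g = 1%g.
  apply/permP => i; apply: residue_roots_inj.
  by rewrite /= -frobX perm1 (sextic_frob5 three0 (phi_root i)).
have px : p x = x.
  by apply: residue_roots_inj; rewrite /= -Dp -phix expr1n.
have p_move y : p y = y -> y = x.
  move=> py; apply: residue_roots_inj; rewrite /= -phix.
  by apply: sextic_frob_fixed (phi_root y) _; rewrite // Dp py.
(* Otherwise every automorphism would fix [r x], making it an integer root of the sextic. *)
have [g Gg gx] : exists2 g, g \in G & g x != x.
  have [//|noG] := pselect (exists2 g, g \in G & g x != x).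
  have : \val (r x) \in Num.int.
    apply: Cint_rat_Aint (aintP _); apply: fixed_Crat => nu.
    have [g Gg Dg] :=
      aut_level0_perms (inj_comp val_inj r_inj) (sextic_roots_stable nu).
    rewrite [LHS]Dg; congr (\val (r _)); apply: contrapT => /eqP gx.
    by apply: noG; exists g.
  case/intrP => z xz; have := sextic_no_int_root z; rewrite -xz.
  by case/negP; apply/(sextic_rootP (\val : {rmorphism aint -> algC})); exists x.
apply: (trans_nonsolvable_nearly_cyclic (l := 5) _ _ p5 px p_move _ Gp Gg gx);
  rewrite ?card_ord //.
(* 6 is not a prime power: both 2 and 3 divide it. *)
move=> q q_pr; apply/negP => /(pnatP _ _)/= q6.
by have := q6 isT 2 isT isT; have := q6 isT 3 isT isT; rewrite !inE => /eqP<-.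
Qed.

End ResidueField.
End SexticRoots.

(** By transitivity automorphisms carry one root to all the others, so all would have level [n] and
    the group would be solvable. *)
Lemma sextic_root_not_level n (x : algC) :
  root (sextic algC) x -> ~ derived_level n x.
Proof.
have [r Dr] := sextic_roots_aint; have [k [phi k3]] := residue_field3_exists.
move=> /(sextic_rootP Dr (\val : {rmorphism aint -> algC}))[i ->] lev_i.
have [trG /negP[]] := sextic_group Dr phi k3.
apply: (@solvable_level_perms _ _ _ n) => [j1 j2 /val_inj r12|j].
  by apply: (residue_roots_inj Dr k3 (phi := phi)); rewrite /= r12.
have [g Gg ->] := atransP2 trG (in_setT i) (in_setT j).
have /level0_permsP[nu Dnu] := Gg.
by rewrite -[r _ : algC]Dnu; exact: derived_level_aut.
Qed.

(** * The graph *)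

Lemma sextic_graph_eigen (R : comNzRingType) (x v0 v1 v2 v3 v4 v5 : R) :
  v1 + v2 + v4 + v5 = x * v0 ->
  v0 + v2 + v3 + v4 = x * v1 ->
  v0 + v1 + v3 = x * v2 ->
  v1 + v2 = x * v3 ->
  v0 + v1 = x * v4 ->
  v0 = x * v5 ->
  let f := (sextic R).[x] in
  [/\ f * v0 = 0, f * v1 = 0, f * v2 = 0, f * v3 = 0 & f * v4 = 0 /\ f * v5 = 0].
Proof.
move=> h0 h1 h2 h3 h4 h5; rewrite /= horner_sextic.
have comb (f c0 c1 c2 c3 c4 c5 : R) :
    f = c0 * (x * v0 - (v1 + v2 + v4 + v5)) +
        c1 * (x * v1 - (v0 + v2 + v3 + v4)) +
        c2 * (x * v2 - (v0 + v1 + v3)) +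
        c3 * (x * v3 - (v1 + v2)) +
        c4 * (x * v4 - (v0 + v1)) +
        c5 * (x * v5 - v0) ->
    f = 0.
  by rewrite h0 h1 h2 h3 h4 h5 !subrr !mulr0 !addr0.
(* The multipliers are the entries of the adjugate of [x - A], where [A] is the
   adjacency matrix of the 6-vertex graph. *)
split; last split.
- by apply: (comb _ (x ^+ 5 - 4 * x ^+ 3 - 2 * x ^+ 2 + x)
    (x ^+ 4 + 2 * x ^+ 3 - x)
    (x ^+ 4 + x ^+ 3 + x)
    (2 * x ^+ 3 + 3 * x ^+ 2)
    (x ^+ 4 + x ^+ 3 - 2 * x ^+ 2 - 2 * x)
    (x ^+ 4 - 4 * x ^+ 2 - 2 * x + 1)); ring.
- by apply: (comb _ (x ^+ 4 + 2 * x ^+ 3 - x)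
    (x ^+ 5 - 4 * x ^+ 3 + 2 * x)
    (x ^+ 4 + 2 * x ^+ 3 - x ^+ 2 - 2 * x)
    (x ^+ 4 + x ^+ 3 - 2 * x ^+ 2 - x)
    (x ^+ 4 + x ^+ 3 - 2 * x ^+ 2 + 1)
    (x ^+ 3 + 2 * x ^+ 2 - 1)); ring.
- by apply: (comb _ (x ^+ 4 + x ^+ 3 + x)
    (x ^+ 4 + 2 * x ^+ 3 - x ^+ 2 - 2 * x)
    (x ^+ 5 - 5 * x ^+ 3 - 2 * x ^+ 2 + 3 * x)
    (x ^+ 4 + x ^+ 3 - 3 * x ^+ 2 - 3 * x + 1)
    (2 * x ^+ 3 + 3 * x ^+ 2 - x - 1)
    (x ^+ 3 + x ^+ 2 + 1)); ring.
- by apply: (comb _ (2 * x ^+ 3 + 3 * x ^+ 2)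
    (x ^+ 4 + x ^+ 3 - 2 * x ^+ 2 - x)
    (x ^+ 4 + x ^+ 3 - 3 * x ^+ 2 - 3 * x + 1)
    (x ^+ 5 - 6 * x ^+ 3 - 4 * x ^+ 2 + 2 * x)
    (x ^+ 3 + 3 * x ^+ 2 + x - 1)
    (2 * x ^+ 2 + 3 * x)); ring.
- by apply: (comb _ (x ^+ 4 + x ^+ 3 - 2 * x ^+ 2 - 2 * x)
    (x ^+ 4 + x ^+ 3 - 2 * x ^+ 2 + 1)
    (2 * x ^+ 3 + 3 * x ^+ 2 - x - 1)
    (x ^+ 3 + 3 * x ^+ 2 + x - 1)
    (x ^+ 5 - 6 * x ^+ 3 - 4 * x ^+ 2 + 3 * x + 2)
    (x ^+ 3 + x ^+ 2 - 2 * x - 2)); ring.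
- by apply: (comb _ (x ^+ 4 - 4 * x ^+ 2 - 2 * x + 1)
    (x ^+ 3 + 2 * x ^+ 2 - 1)
    (x ^+ 3 + x ^+ 2 + 1)
    (2 * x ^+ 2 + 3 * x)
    (x ^+ 3 + x ^+ 2 - 2 * x - 2)
    (x ^+ 5 - 7 * x ^+ 3 - 6 * x ^+ 2 + 3 * x + 2)); ring.
Qed.

Definition sextic_edge (i j : nat) : bool :=
  let E :=
    [:: (0, 1); (0, 2); (0, 4); (0, 5); (1, 2); (1, 3); (1, 4); (2, 3)]%N in
  ((i, j) \in E) || ((j, i) \in E).

Definition double_edge (i j : nat) : bool :=
  (i %/ 6 == j %/ 6)%N && sextic_edge (i %% 6) (j %% 6).

Lemma double_graph_simple : simple_graph (fun i j : 'I_12 => double_edge i j).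
Proof.
split=> [i|i j]; last by rewrite /double_edge /sextic_edge eq_sym orbC.
rewrite /double_edge eqxx; case: i => i /= _.
by have := ltn_pmod i (isT : 0 < 6)%N; case: (i %% 6)%N => [|[|[|[|[|[|]]]]]].
Qed.

(** Each half of [u] satisfies the six eigenvector equations of one copy, so the value of the sextic
    at [x] annihilates all twelve coordinates. *)
Lemma double_graph_eigenvalue (u : 'cV[algC]_12) (x : algC) :
  adjmx (fun i j : 'I_12 => double_edge i j) *m u = x *: u -> u != 0 ->
  root (sextic algC) x.
Proof.
move=> Au u0; pose w (i : nat) := u (inord i) 0.
have sum12 (F : nat -> algC) : \sum_(j < 12) F j =
    F 0 + F 1 + F 2 + F 3 + F 4 + F 5 + F 6 + F 7 + F 8 + F 9 + F 10 + F 11.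
  by rewrite !big_ord_recr big_ord0 /= add0r.
have Aw i : (i < 12)%N ->
    let F j := (double_edge i j)%:R * w j in
    F 0 + F 1 + F 2 + F 3 + F 4 + F 5 + F 6 + F 7 + F 8 + F 9 + F 10 + F 11
      = x * w i.
  move=> i12 F; rewrite -sum12 /F.
  have := congr1 (fun v : 'cV_12 => v (inord i) 0) Au.
  rewrite !mxE => <-; apply: eq_bigr => j _.
  by rewrite mxE inordK // /w inord_val.
apply: contraNT u0 => fx0; apply/eqP/matrixP => i j; rewrite ord1 mxE.
rewrite -[i]inord_val -/(w i).
have wP y : (sextic algC).[x] * y = 0 -> y = 0.
  by move/eqP; rewrite mulf_eq0 => /orP[fx|/eqP //]; case/negP: fx0.
have E := (Aw 0 isT, Aw 1 isT, Aw 2 isT, Aw 3 isT, Aw 4 isT, Aw 5 isT, Aw 6 isT,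
  Aw 7 isT, Aw 8 isT, Aw 9 isT, Aw 10 isT, Aw 11 isT)%N.
rewrite /= !(mul0r, mul1r, add0r, addr0) in E.
case: E => [[[[[[[[[[[e0 e1] e2] e3] e4] e5] e6] e7] e8] e9] e10] e11].
have [z0 z1 z2 z3 [z4 z5]] := sextic_graph_eigen e0 e1 e2 e3 e4 e5.
have [z6 z7 z8 z9 [z10 z11]] := sextic_graph_eigen e6 e7 e8 e9 e10 e11.
by case: i => [[|[|[|[|[|[|[|[|[|[|[|[|//]]]]]]]]]]]] i12] /=; apply: wP.
Qed.

(** * Levels of the values computed by a radical tree *)

Lemma rop_level n (M : 'M[algC]_n) d (env : seq algC) (o : rop n) :
  (forall i j, derived_level d (M i j)) ->
  (forall k, derived_level d (nth 0 env k)) ->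
  derived_level d.+2 (rop_eval M env o).
Proof.
move=> Md envd; have up x : derived_level d x -> derived_level d.+2 x.
  by move=> xd; do 2 apply: derived_levelS.
case: o => [z|i j|a b|a b|a b|a b|k a|a]; rewrite /rop_eval.
- exact: derived_level_int.
- exact/up.
- exact/up/derived_levelD.
- by apply/up/derived_levelD => //; exact: derived_levelN.
- exact/up/derived_levelM.
- by apply/up/derived_levelM => //; exact: derived_levelV.
(* The 0-th root is 0 by convention. *)
- have [->|k_gt0] := posnP k.
    by rewrite root0C; exact: (derived_level_int _ 0).
  exact: (derived_level_root k_gt0 (rootCK k_gt0 _)).
- by apply: up; exact: (derived_level_aut (Num.conj_op : autC)).
Qed.

(** Each computation node on the path taken raises the bound by two, and a decision only selects a
    subtree. Indices out of range read 0, which has every level. *)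
Lemma rtree_level n (M : 'M[algC]_n) (t : rtree n) d (env : seq algC) :
  (forall i j, derived_level d (M i j)) ->
  (forall k, derived_level d (nth 0 env k)) ->
  exists d', forall k, derived_level d' (nth 0 (rtree_eval_env M env t) k).
Proof.
elim: t d env => [outs|o t IHt|a tp IHp tn IHn] d env Md envd /=.
- exists d => k; have [kouts|outsk] := ltnP k (size outs).
    by rewrite (nth_map 0%N).
  by rewrite nth_default ?size_map //; exact: (derived_level_int d 0).
- apply: (IHt d.+2) => [i j|k]; first by do 2 apply: derived_levelS.
  rewrite nth_rcons; case: ifP => _; first by do 2 apply: derived_levelS.
  case: ifP => _; first exact: rop_level.
  exact: (derived_level_int _ 0).
- by case: ifP => _; [apply: IHp envd | apply: IHn envd].
Qed.

Theorem theorem8 :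
  exists e : rel 'I_12, simple_graph e /\
    forall t : rtree 12,
      ~ spectral_drawing (adjmx e) (@output_drawing 12 (rtree_eval (adjmx e) t)).
Proof.
exists (fun i j => double_edge i j); split; first exact: double_graph_simple.
set e := (fun i j : 'I_12 => _); set A := adjmx e.
move=> t [U [lam [r [s [[_ Uu] eigU _ _ Dpos]]]]].
have A0 i j : derived_level 0 (A i j) by rewrite mxE => nu; rewrite rmorph_nat.
have [|d outd] := rtree_level t (env := [::]) A0.
  by move=> k; rewrite nth_nil; exact: (derived_level_int 0 0).
have Ud i : derived_level d (U i r).
  by have [<- _] := Dpos i; exact: outd.
have Ur0 : col r U != 0.
  apply: contraTneq Uu => Ur0.
  rewrite unitmxE (expand_det_col _ r) big1 ?unitr0 //.
  by move=> i _; have /matrixP/(_ i 0) := Ur0; rewrite !mxE => ->; rewrite mul0r.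
have [i Uir] : exists i, U i r != 0.
  apply/existsP; apply: contraNT Ur0 => /existsPn U0; apply/eqP/matrixP => i j.
  by rewrite !mxE; apply/eqP; have := U0 i; rewrite negbK.
apply: (@sextic_root_not_level d (lam r)).
  exact: double_graph_eigenvalue (eigU r) Ur0.
(* At a nonzero coordinate [U i r], the eigenvalue is the quotient of the [i]-th entry of
   [A *m col r U] by [U i r], hence of level [d]. *)
have /matrixP/(_ i 0) := eigU r; rewrite !mxE => lamE.
rewrite -[lam r](mulfK Uir) -lamE.
apply: derived_levelM; last exact: derived_levelV.
apply: derived_level_sum => j; apply: derived_levelM; last by rewrite mxE.
exact: derived_level_le (A0 i j).
Qed.
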